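(* Let $\mathbb{T}\subseteq\mathbb{R}$ be an arbitrary time scale with forward graininess function $\mu$. Then for every $t\in\mathbb{T}$, $$\cosh_{\mathbb{T}}^2(t)-\sinh_{\mathbb{T}}^2(t)=\frac{e^{\mu(t)}+e^{-\mu(t)}-2}{\mu(t)^2},$$ where $\sinh_{\mathbb{T}}$ and $\cosh_{\mathbb{T}}$ are the time-scale hyperbolic sine and cosine functions, and expressions of the form $0/0$ at $\mu(t)=0$ are replaced by their limits as $\mu(t)\to0$ (so that the right-hand side equals $1$ when $\mu(t)=0$).
   Context: A time scale $\mathbb{T}$ is a nonempty closed subset of $\mathbb{R}$. The forward jump operator is $\sigma(t)=\inf\{s\in\mathbb{T}: s>t\}$ for $t\in\mathbb{T}$, $t\neq\sup\mathbb{T}$, and $\sigma(\sup\mathbb{T})=\sup\mathbb{T}$ if $\sup\mathbb{T}<+\infty$. The forward graininess function is $\mu:\mathbb{T}\to[0,\infty)$, $\mu(t)=\sigma(t)-t$. The time-scale hyperbolic sine and cosine $\sinh_{\mathbb{T}},\cosh_{\mathbb{T}}:\mathbb{T}\to\mathbb{R}$ are defined by $$\sinh_{\mathbb{T}}(t)=\frac{\left(e^{t+\mu(t)}-e^{t}\right)+\left(e^{-(t+\mu(t))}-e^{-t}\right)}{2\mu(t)},\qquad \cosh_{\mathbb{T}}(t)=\frac{\left(e^{t+\mu(t)}-e^{t}\right)-\left(e^{-(t+\mu(t))}-e^{-t}\right)}{2\mu(t)}.$$ Convention: when $\mu(t)=0$, an expression of the form $0/0$ is interpreted as its limit as the value $\mu(t)$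 is replaced by a real variable $\mu\to0$ with $t$ fixed; thus $\sinh_{\mathbb{T}}(t)=\sinh t$ and $\cosh_{\mathbb{T}}(t)=\cosh t$ when $\mu(t)=0$. *)

(* Defs.v *)
From HB Require Import structures.
From mathcomp Require Import all_boot all_order all_algebra.
From mathcomp Require Import all_classical all_reals all_analysis.

Set Implicit Arguments.
Unset Strict Implicit.
Unset Printing Implicit Defensive.

Import Order.TTheory GRing.Theory Num.Theory.
Import numFieldNormedType.Exports.

Local Open Scope classical_set_scope.
Local Open Scope ring_scope.

Definition time_scale (R : realType) (T : set R) : Prop :=
  T !=set0 /\ closed T.

(* The supremum is taken in the extended reals, so that [t = sup T] can only
   hold when [T] is bounded above.  Functions on the time scale are total
   functions on [R]; only their values at points of [T] are meaningful. *)
Definition forward_jump (R : realType) (T : set R) (t : R) : R :=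
  if t%:E == ereal_sup [set s%:E | s in T] then t
  else inf [set s | T s /\ t < s].

Definition graininess (R : realType) (T : set R) (t : R) : R :=
  forward_jump T t - t.

(* Convention for an expression [F mu] of the form 0/0 at [mu = 0]: it stands
   for the limit of [F m] as the real variable [m] tends to 0, [m != 0]. *)
Definition lim_if0 (R : realType) (F : R -> R) (mu : R) : R :=
  if mu == 0 then lim (F m @[m --> (0 : R)^']) else F mu.

Definition sinhT (R : realType) (T : set R) (t : R) : R :=
  lim_if0 (fun m => ((expR (t + m) - expR t)
                     + (expR (- (t + m)) - expR (- t))) / (2 * m))
          (graininess T t).

Definition coshT (R : realType) (T : set R) (t : R) : R :=
  lim_if0 (fun m => ((expR (t + m) - expR t)
                     - (expR (- (t + m)) - expR (- t))) / (2 * m))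
          (graininess T t).

(* Main.v *)
(* The identity holds pointwise in the real variable replacing the graininess:
   with a = e^(t+m) - e^t and b = e^(-(t+m)) - e^(-t), both sides are
   -ab / m^2.  The 0/0 case follows by passing to the limit, where a / m and
   b / m are difference quotients tending to e^t and -e^(-t); thus the limit of
   the right-hand side is e^t e^(-t) = 1, without any second-order expansion. *)
Require Import Defs.
From HB Require Import structures.
From mathcomp Require Import all_boot all_order all_algebra.
From mathcomp Require Import all_classical all_reals all_analysis.
From mathcomp Require Import ring.

Set Implicit Arguments.
Unset Strict Implicit.
Unset Printing Implicit Defensive.

Import Order.TTheory GRing.Theory Num.Theory.
Import numFieldNormedType.Exports.

Local Open Scope classical_set_scope.
Local Open Scope ring_scope.

(** Bridges from the scaled form [m^-1 *: (f (m *: 1 + x) - f x)] underlying [derive] to an ordinary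
    quotient. *)
Lemma cvg_difference_quotient (R : realType) (f : R -> R) (x df : R) :
  is_derive x 1 f df -> (f (x + m) - f x) / m @[m --> (0 : R)^'] --> df.
Proof.
move=> [fx <-]; move: fx; rewrite /derivable /derive => fx.
apply: cvg_trans fx; apply: near_eq_cvg; near=> m => /=.
by rewrite [m *: 1]mulr1 [m + x]addrC [LHS]mulrC.
Unshelve. all: by end_near. Qed.

Lemma cvg_expR_quotient (R : realType) (t : R) :
  (expR (t + m) - expR t) / m @[m --> (0 : R)^'] --> expR t.
Proof. exact: cvg_difference_quotient. Qed.

Lemma cvg_expRN_quotient (R : realType) (t : R) :
  (expR (- (t + m)) - expR (- t)) / m @[m --> (0 : R)^'] --> - expR (- t).
Proof.
apply: (@cvg_difference_quotient _ (fun x => expR (- x))).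
by apply: is_derive_eq; rewrite ?scaleN1r ?scalerN1 ?mulrN1 ?mulN1r.
Qed.

Lemma cvg_sinh_quotient (R : realType) (t : R) :
  ((expR (t + m) - expR t) + (expR (- (t + m)) - expR (- t))) / (2 * m)
    @[m --> (0 : R)^'] --> (expR t - expR (- t)) / 2.
Proof.
(* Regroups [(a + b) / (2 * m)] as [(a / m + b / m) / 2], a combination of two difference
   quotients. *)
under eq_fun do rewrite invfM mulrCA mulrC mulrDl.
apply: cvgMr_tmp; apply: cvgD; [exact: cvg_expR_quotient | exact: cvg_expRN_quotient].
Qed.

Lemma cvg_cosh_quotient (R : realType) (t : R) :
  ((expR (t + m) - expR t) - (expR (- (t + m)) - expR (- t))) / (2 * m)
    @[m --> (0 : R)^'] --> (expR t + expR (- t)) / 2.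
Proof.
under eq_fun do rewrite invfM mulrCA mulrC mulrBl.
rewrite -[X in expR t + X]opprK.
apply: cvgMr_tmp; apply: cvgB; [exact: cvg_expR_quotient | exact: cvg_expRN_quotient].
Qed.

(* Also true at m = 0, where Rocq's division makes both sides 0. *)
Lemma cosh_sinh_quotient (R : realType) (t m : R) :
  (((expR (t + m) - expR t) - (expR (- (t + m)) - expR (- t))) / (2 * m)) ^+ 2
  - (((expR (t + m) - expR t) + (expR (- (t + m)) - expR (- t))) / (2 * m)) ^+ 2
  = (expR m + expR (- m) - 2) / m ^+ 2.
Proof.
have [->|m0] := eqVneq m 0.
  by rewrite mulr0 invr0 expr0n invr0 !mulr0 expr0n subrr.
have := expRxMexpNx_1 t; have := expRxMexpNx_1 m.
rewrite (opprD t) !expRD; set a := expR t; set b := expR (- t).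
set c := expR m; set d := expR (- m) => cd ab.
(* The difference of squares leaves [- (a * (c - 1)) * (b * (d - 1))] over [m ^+ 2]; then
   [a * b = 1] and [c * d = 1] finish. *)
transitivity ((a * b * (c + d - c * d - 1)) / m ^+ 2); first by field.
by rewrite ab cd mul1r -addrA -opprD.
Qed.

(** The pointwise identity at [t = 0] makes this a difference of squares of first-order quotients,
    which tend to cosh 0 = 1 and sinh 0 = 0. *)
Lemma cvg_exp_second_quotient (R : realType) :
  (expR m + expR (- m) - 2) / m ^+ 2 @[m --> (0 : R)^'] --> (1 : R).
Proof.
under eq_fun do rewrite -(cosh_sinh_quotient 0).
have cC := @cvg_cosh_quotient R 0; have cS := @cvg_sinh_quotient R 0.
have E : ((expR 0 + expR (- 0)) / 2) * ((expR 0 + expR (- 0)) / 2)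
    - ((expR 0 - expR (- 0)) / 2) * ((expR 0 - expR (- 0)) / 2) = 1 :> R.
  by rewrite oppr0 expR0; field.
have := cvgB (cvgM cC cC) (cvgM cS cS); rewrite E => cCS.
exact: cCS.
Qed.

Theorem theorem5p7 (R : realType) (T : set R) (hT : time_scale T)
    (t : R) (ht : T t) :
  let rhs := lim_if0 (fun m : R => (expR m + expR (- m) - 2) / m ^+ 2)
                     (graininess T t) in
  coshT T t ^+ 2 - sinhT T t ^+ 2 = rhs
  /\ (graininess T t = 0 -> rhs = 1).
Proof.
move=> rhs; rewrite {}/rhs /coshT /sinhT /lim_if0.
have [mu0|mu0] := eqVneq (graininess T t) 0; last first.
  by split; [exact: cosh_sinh_quotient | move=> mu; rewrite mu eqxx in mu0].
rewrite (cvg_lim _ (@cvg_cosh_quotient _ t))// (cvg_lim _ (@cvg_sinh_quotient _ t))//.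
rewrite (cvg_lim _ (@cvg_exp_second_quotient R))//; split=> //.
(* Writing 1 as [expR t * expR (- t)] leaves a polynomial identity in these two exponentials. *)
by rewrite -[RHS](expRxMexpNx_1 t); field.
Qed.
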